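(* Let $G:\mathbb{R}^n\rightrightarrows\mathbb{R}^m$ be a polyhedral multifunction whose graph is expressed as the union of finitely many polyhedral sets $G_i\subset\mathbb{R}^n\times\mathbb{R}^m$, $1\le i\le l$. Assume that (i) $\operatorname{dom}G$ is convex; (ii) $\operatorname{gph}G|_{Q_i}$ is convex for all $1\le i\le l$, where $Q_i$ is the image of $G_i$ under the projection mapping $(x,y)\mapsto x$. Then $G$ is Lipschitz continuous not only on each $Q_i$ with some constant $\kappa_i>0$, but also on its domain $\operatorname{dom}G$ with constant $\max_{1\le i\le l}\kappa_i$.
   Context: For a multifunction $G:\mathbb{R}^n\rightrightarrows\mathbb{R}^m$: $\operatorname{gph}G=\{(x,y)\mid y\in G(x)\}$, $\operatorname{dom}G=\{x\mid G(x)\ne\emptyset\}$; for $\Omega\subset\mathbb{R}^n$ the restriction $G|_\Omega$ is $G|_\Omega(x)=G(x)$ if $x\in\Omega$ and $\emptyset$ otherwise, so $\operatorname{gph}G|_\Omega=\operatorname{gph}G\cap(\Omega\times\mathbb{R}^m)$. A polyhedral set is the solution set of a finite system of linear inequalities $\alpha_j^\top x\le\beta_j$. $G$ is a polyhedral multifunction if its graph is a union of finitely many polyhedral sets. $G$ is Lipschitz continuous on $X\subset\mathbb{R}^n$ with constant $\kappa\ge0$ if $G(x)$ is nonempty and closed for every $x\in X$ and $G(x')\subset G(x)+\kappa\|x'-x\|\mathbb{B}$ for all $x,x'\in X$, where $\|\cdot\|$ is the Euclidean norm and $\mathbb{B}$ the closed unit Euclidean ball. *)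

(* Defs.v *)
From HB Require Import structures.
From mathcomp Require Import all_boot all_order all_algebra.
From mathcomp Require Import all_classical all_reals all_analysis.
Import Order.TTheory GRing.Theory Num.Theory.
Import numFieldNormedType.Exports.

Set Implicit Arguments.
Unset Strict Implicit.
Unset Printing Implicit Defensive.

Local Open Scope classical_set_scope.
Local Open Scope ring_scope.

Section Multifunctions.
Variable R : realType.

(* The library's norm on 'cV[R]_p is the sup norm, so the Euclidean norm is
   defined here; both induce the topology used by [closed]. *)
Definition enorm (p : nat) (x : 'cV[R]_p) : R :=
  Num.sqrt (\sum_(i < p) x i 0 ^+ 2).

Definition unit_eball (p : nat) : set 'cV[R]_p := [set b | enorm b <= 1].

(* The empty system (k = 0) is allowed and yields the whole space. *)
Definition polyhedral (p : nat) (A : set 'cV[R]_p) : Prop :=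
  exists (k : nat) (alpha : 'I_k -> 'cV[R]_p) (beta : 'I_k -> R),
    A = [set x | forall j, ((alpha j)^T *m x) 0 0 <= beta j].

(* Identifies R^n x R^m with R^(n + m). *)
Definition stack_cV (n m : nat) (z : 'cV[R]_n * 'cV[R]_m) : 'cV[R]_(n + m) :=
  col_mx z.1 z.2.

Definition polyhedral2 (n m : nat) (A : set ('cV[R]_n * 'cV[R]_m)) : Prop :=
  polyhedral (@stack_cV n m @` A).

Section Multifunction.
Variables n m : nat.
Implicit Type G : 'cV[R]_n -> set 'cV[R]_m.

Definition mf_gph G : set ('cV[R]_n * 'cV[R]_m) := [set z | G z.1 z.2].

Definition mf_dom G : set 'cV[R]_n := [set x | G x !=set0].

Definition mf_restrict G (Omega : set 'cV[R]_n) : 'cV[R]_n -> set 'cV[R]_m :=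
  fun x => if x \in Omega then G x else set0.

Definition polyhedral_decomposition G (l : nat)
    (Gs : 'I_l -> set ('cV[R]_n * 'cV[R]_m)) : Prop :=
  (forall i, polyhedral2 (Gs i)) /\ mf_gph G = \bigcup_(i in [set: 'I_l]) Gs i.

Definition polyhedral_multifunction G : Prop :=
  exists (l : nat) (Gs : 'I_l -> set ('cV[R]_n * 'cV[R]_m)),
    polyhedral_decomposition G Gs.

Definition mf_lipschitz G (X : set 'cV[R]_n) (kappa : R) : Prop :=
  [/\ 0 <= kappa,
      forall x, X x -> G x !=set0 /\ closed (G x) &
      forall x x', X x -> X x' ->
        G x' `<=` [set y + (kappa * enorm (x' - x)) *: b
                  | y in G x & b in @unit_eball m] ].

End Multifunction.
End Multifunctions.

(* Main.v *)
Require Import Defs.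
From HB Require Import structures.
From mathcomp Require Import all_boot all_order all_algebra.
From mathcomp Require Import all_classical all_reals all_analysis.
From mathcomp Require Import ring lra.
Import Order.TTheory GRing.Theory Num.Theory.
Import numFieldNormedType.Exports.

Set Implicit Arguments.
Unset Strict Implicit.
Unset Printing Implicit Defensive.

Local Open Scope classical_set_scope.
Local Open Scope ring_scope.

(** Two facts make the theorem work.

    A single polyhedral piece has a closed projection and a Lipschitz selection
    (Hoffman's bound): given [y'] over [x'] and a point [x] of the projection,
    some [y] over [x] lies within [kappa |x' - x|] of [y']. Both follow from
    Fourier-Motzkin elimination of the coordinates of [y]: eliminating one
    coordinate leaves a polyhedral system in fewer unknowns, and the eliminated
    coordinate ranges over an interval whose ends are Lipschitz in the remaining
    ones ([satisfies_dom_closed_lipschitz]).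

    Along a segment these constants are propagated by the closedness of finitely
    many sets: if a set of the family contains a point of the segment whose
    parameter is close enough to [s], then it contains the point of parameter [s]
    ([near_segment_closed]).

    On [Q i], the constants of the pieces cannot simply be chained: where the
    projections of two pieces meet, a value selected from one piece need not
    belong to the other. Convexity of the graph over [Q i] replaces chaining. The
    distance from [y'] to the value at the point [x' + t (x - x')] is convex in
    [t] and vanishes at [t = 0], so its value at [t = 1] is at most its slope at
    the right end; that slope is controlled by the one piece containing a nearly
    optimal point just before [x] ([convex_graph_lipschitz]).

    On the domain, the values used are those of [G] itself, so the estimates on
    the sets [Q i] compose along a segment of the convex domain, and the
    distances add up exactly ([lipschitz_selection_cover]). *)

(** * The Euclidean norm *)

Section EuclideanNorm.
Variables (R : realType) (p : nat).
Implicit Types x y z : 'cV[R]_p.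

Definition dot x y : R := (x^T *m y) 0 0.

Lemma dotE x y : dot x y = \sum_(i < p) x i 0 * y i 0.
Proof. by rewrite /dot mxE; apply: eq_bigr => i _; rewrite mxE. Qed.

Lemma dotBl x y z : dot (x - y) z = dot x z - dot y z.
Proof. by rewrite /dot linearB mulmxBl !mxE. Qed.

Lemma dotZl a x y : dot (a *: x) y = a * dot x y.
Proof. by rewrite /dot linearZ /= -scalemxAl mxE. Qed.

Lemma dotBr x y z : dot x (y - z) = dot x y - dot x z.
Proof. by rewrite /dot mulmxBr !mxE. Qed.

Lemma enorm_ge0 x : 0 <= enorm x.
Proof. exact: sqrtr_ge0. Qed.

Lemma enorm_sqr x : enorm x ^+ 2 = dot x x.
Proof.
rewrite /enorm sqr_sqrtr ?dotE; first by apply: eq_bigr.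
by apply: sumr_ge0 => i _; exact: sqr_ge0.
Qed.

Lemma enormZ a x : enorm (a *: x) = `|a| * enorm x.
Proof.
rewrite /enorm -sqrtr_sqr -sqrtrM ?sqr_ge0 // mulr_sumr.
by congr Num.sqrt; apply: eq_bigr => i _; rewrite mxE exprMn.
Qed.

Lemma enorm0 : enorm (0 : 'cV[R]_p) = 0.
Proof. by rewrite -(scale0r (0 : 'cV[R]_p)) enormZ normr0 mul0r. Qed.

Lemma enormBC x y : enorm (x - y) = enorm (y - x).
Proof. by rewrite -opprB -scaleN1r enormZ normrN1 mul1r. Qed.

Lemma enorm_eq0 x : enorm x = 0 -> x = 0.
Proof.
move=> /(congr1 (fun r => r ^+ 2)); rewrite enorm_sqr expr0n dotE /= => /eqP.
rewrite psumr_eq0 => [/allP x0|i _]; last by rewrite -expr2 sqr_ge0.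
apply/colP => i; have := x0 i (mem_index_enum i).
by rewrite /= mulf_eq0 orbb mxE => /eqP.
Qed.

(** Cauchy-Schwarz, obtained by expanding the square of the norm of
    [|y| x - |x| y]. *)
Lemma dot_le_enorm x y : dot x y <= enorm x * enorm y.
Proof.
have [/enorm_eq0 ->|x0] := eqVneq (enorm x) 0.
  by rewrite enorm0 mul0r dotE big1 // => i _; rewrite mxE mul0r.
have [/enorm_eq0 ->|y0] := eqVneq (enorm y) 0.
  by rewrite enorm0 mulr0 dotE big1 // => i _; rewrite mxE mulr0.
have xp : 0 < enorm x by rewrite lt_def x0 enorm_ge0.
have yp : 0 < enorm y by rewrite lt_def y0 enorm_ge0.
have : 0 <= enorm (enorm y *: x - enorm x *: y) ^+ 2 by exact: sqr_ge0.
rewrite enorm_sqr; have -> :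
    dot (enorm y *: x - enorm x *: y) (enorm y *: x - enorm x *: y) =
    enorm y ^+ 2 * dot x x - 2 * enorm x * enorm y * dot x y +
    enorm x ^+ 2 * dot y y.
  rewrite !dotE !mulr_sumr -sumrB -big_split; apply: eq_bigr => i _ /=.
  by rewrite !mxE; ring.
rewrite -!enorm_sqr => h.
have : 0 <= (enorm x * enorm y) * (enorm x * enorm y - dot x y) by lra.
by rewrite pmulr_rge0 ?mulr_gt0 // subr_ge0.
Qed.

Lemma enormD x y : enorm (x + y) <= enorm x + enorm y.
Proof.
rewrite -ler_sqr ?nnegrE ?addr_ge0 ?enorm_ge0 //.
rewrite enorm_sqr dotE sqrrD !enorm_sqr !dotE.
have := dot_le_enorm x y; rewrite dotE => h.
rewrite [leLHS](_ : _ = \sum_(i < p) x i 0 * x i 0 +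
  (\sum_(i < p) x i 0 * y i 0) *+ 2 + \sum_(i < p) y i 0 * y i 0).
  by rewrite lerD2r lerD2l lerMn2r.
rewrite -sumrMnl -!big_split; apply: eq_bigr => i _ /=; rewrite mxE; ring.
Qed.

Lemma enorm_triangle y x z : enorm (x - z) <= enorm (x - y) + enorm (y - z).
Proof. by rewrite -[x - z](subrKA y) enormD. Qed.

Lemma continuous_dot x : continuous (dot x).
Proof.
rewrite (_ : dot x = fun y => \sum_(i < p) x i 0 * y i 0); last first.
  by apply/funext => y; rewrite dotE.
apply: (continuous_big (@add_continuous R^o)
  (F := fun i (y : 'cV[R]_p) => x i 0 * y i 0)) => i _ y.
by apply: continuousM; [exact: cst_continuous | exact: coord_continuous].
Qed.

Lemma closed_halfspace x (r : R) : closed [set y | dot x y <= r].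
Proof.
have /continuous_closedP dot_closed := @continuous_dot x.
exact: (dot_closed _ (@closed_le _ r)).
Qed.

End EuclideanNorm.

Lemma enorm_col_mx (R : realType) (p q : nat) (x : 'cV[R]_p) (y : 'cV[R]_q) :
  enorm (col_mx x y) <= enorm x + enorm y.
Proof.
rewrite -ler_sqr ?nnegrE ?addr_ge0 ?enorm_ge0 //.
rewrite enorm_sqr sqrrD !enorm_sqr {1}/dot tr_col_mx mul_row_col mxE.
rewrite -!/(dot _ _).
by rewrite -addrA lerD2l lerDr mulrn_wge0 // mulr_ge0 ?enorm_ge0.
Qed.

Lemma enorm_col_mxB (R : realType) (q : nat) (s t : R) (y z : 'cV[R]_q) :
  enorm (col_mx s%:M y - col_mx t%:M z : 'cV_(1 + q)) <=
  `|s - t| + enorm (y - z).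
Proof.
rewrite opp_col_mx add_col_mx -raddfB /=.
apply: (le_trans (enorm_col_mx _ _)); rewrite lerD2r.
by rewrite {1}/enorm big_ord1 mxE eqxx mulr1n sqrtr_sqr.
Qed.

(** * Linear inequalities in one unknown *)

Section OneVariable.
Variable R : realType.

Lemma between_seqs (L U : seq R) :
  (forall a b, a \in L -> b \in U -> a <= b) ->
  exists s, (forall a, a \in L -> a <= s) /\ (forall b, b \in U -> s <= b).
Proof.
elim: L => [_|a L IH LU].
  elim: U => [|b U [s [_ sU]]]; first by exists 0.
  exists (Num.min b s); split=> // c; rewrite inE ge_min => /predU1P[->|/sU ->].
    by rewrite lexx.
  by rewrite orbT.
have [c d cL dU|s [Ls sU]] := IH; first by apply: LU; rewrite // inE cL orbT.
exists (Num.max a s); split=> [c|b bU].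
  by rewrite inE le_max => /predU1P[->|/Ls ->]; rewrite ?lexx ?orbT.
by rewrite ge_max sU // LU // inE eqxx.
Qed.

(** The constraints with negative coefficient bound the unknown from below, those
    with positive coefficient bound it from above; the pairwise condition says
    that no lower bound exceeds an upper bound. A pair [c] stands for the
    constraint [c.1 * s <= c.2]. *)
Lemma one_variable_feasible (S : seq (R * R)) :
  (exists s, forall c, c \in S -> c.1 * s <= c.2) <->
  (forall c, c \in S -> c.1 = 0 -> 0 <= c.2) /\
  (forall c d, c \in S -> d \in S -> c.1 < 0 -> 0 < d.1 ->
     0 <= d.1 * c.2 - c.1 * d.2).
Proof.
split=> [[s sS]|[S0 Spm]].
  split=> [c /sS + c0|c d /sS cs /sS ds cn dp]; first by rewrite c0 mul0r.
  have := ler_wpM2l (ltW dp) cs; have := ler_wnM2l (ltW cn) ds; lra.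
have [a b|s [Ls sU]] :=
    @between_seqs [seq c.2 / c.1 | c <- S & c.1 < 0]
                  [seq c.2 / c.1 | c <- S & 0 < c.1].
  move=> /mapP[c + ->] /mapP[d + ->]; rewrite !mem_filter.
  move=> /andP[cn cS] /andP[dp dS]; rewrite ler_pdivlMr // mulrAC.
  by rewrite ler_ndivrMr //; have := Spm _ _ cS dS cn dp; lra.
exists s => c cS; have [cn|cp|c0] := ltgtP c.1 0; last first.
- by rewrite c0 mul0r; apply: S0.
- rewrite mulrC -ler_pdivlMr //; apply: sU; apply/mapP; exists c => //.
  by rewrite mem_filter cp.
- rewrite mulrC -ler_ndivrMr //; apply: Ls; apply/mapP; exists c => //.
  by rewrite mem_filter cn.
Qed.

(** Adding the two constraints [s <= s' + M] and [s' - M <= s] to a feasible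
    system creates new pairs only with constraints that [s'] violates by at most
    [M |c|], so the pairwise criterion still holds. *)
Lemma one_variable_near (S : seq (R * R)) (s' M : R) :
  0 <= M ->
  (exists s, forall c, c \in S -> c.1 * s <= c.2) ->
  (forall c, c \in S -> c.1 * s' <= c.2 + `|c.1| * M) ->
  exists2 s, forall c, c \in S -> c.1 * s <= c.2 & `|s' - s| <= M.
Proof.
move=> M0 /one_variable_feasible[S0 Spm] near_s'.
have [s sS] : exists s, forall c,
    c \in [:: (1, s' + M), (- 1, M - s') & S] -> c.1 * s <= c.2.
  apply/one_variable_feasible; split=> [c|c d].
    by rewrite !inE => /or3P[/eqP->|/eqP->|/S0 //] /=; lra.
  rewrite !inE => /or3P[/eqP->|/eqP->|cS] /or3P[/eqP->|/eqP->|dS] /= cn dp;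
    try lra; last exact: Spm.
    by have := near_s' _ dS; rewrite gtr0_norm //; lra.
  by have := near_s' _ cS; rewrite ltr0_norm //; lra.
exists s => [c cS|]; first by apply: sS; rewrite !inE cS !orbT.
have := sS (1, s' + M); have := sS (- 1, M - s').
rewrite !inE !eqxx ?orbT /= => /(_ isT) h1 /(_ isT) h2.
by rewrite ler_norml; lra.
Qed.

End OneVariable.

(** * Fourier-Motzkin elimination and Hoffman's bound *)

Section Elimination.
Variables (R : realType) (n : nat).

Definition satisfies (m : nat) (S : seq ('cV[R]_n * 'cV[R]_m * R))
    (x : 'cV[R]_n) (y : 'cV[R]_m) : Prop :=
  forall c, c \in S -> dot c.1.1 x + dot c.1.2 y <= c.2.

(** The unknown to eliminate is the first coordinate of [y], whence [1 + m]. *)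
Section Step.
Variables (m : nat) (S : seq ('cV[R]_n * 'cV[R]_(1 + m) * R)).
Implicit Type c : 'cV[R]_n * 'cV[R]_(1 + m) * R.

Let pivot c : R := usubmx c.1.2 0 0.
Let rest c : 'cV[R]_m := dsubmx c.1.2.
Let slack x y c : R := c.2 - dot c.1.1 x - dot (rest c) y.

(** Fourier-Motzkin elimination: each combination of a negative and a positive
    pivot has nonnegative weights chosen to cancel the first coordinate. *)
Definition eliminate : seq ('cV[R]_n * 'cV[R]_m * R) :=
  [seq (c.1.1, rest c, c.2) | c <- S & pivot c == 0] ++
  [seq (pivot d *: c.1.1 - pivot c *: d.1.1,
        pivot d *: rest c - pivot c *: rest d,
        pivot d * c.2 - pivot c * d.2)
     | c <- [seq c <- S | pivot c < 0], d <- [seq d <- S | 0 < pivot d]].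

Lemma dot_pivot c (s : R) (y : 'cV[R]_m) :
  dot c.1.2 (col_mx s%:M y) = pivot c * s + dot (rest c) y.
Proof.
rewrite /dot -[in LHS](vsubmxK c.1.2) tr_col_mx mul_row_col mxE; congr (_ + _).
by rewrite mul_mx_scalar /pivot !mxE mulrC.
Qed.

Lemma satisfies_pivot x (s : R) y : satisfies S x (col_mx s%:M y) <->
  forall e, e \in [seq (pivot c, slack x y c) | c <- S] -> e.1 * s <= e.2.
Proof.
split=> [sat _ /mapP[c cS ->]|sat c cS].
  by have := sat _ cS; rewrite dot_pivot /slack /=; lra.
by have := sat _ (map_f _ cS); rewrite dot_pivot /slack /=; lra.
Qed.

Lemma satisfies_eliminate x y : satisfies eliminate x y <->
  exists s : R, satisfies S x (col_mx s%:M y).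
Proof.
have -> : (exists s : R, satisfies S x (col_mx s%:M y)) <->
    exists s, forall e,
      e \in [seq (pivot c, slack x y c) | c <- S] -> e.1 * s <= e.2.
  by split=> -[s /satisfies_pivot]; exists s.
rewrite one_variable_feasible; split=> [sat|[S0 Spm] e].
  split=> [_ /mapP[c cS ->] /= c0|_ _ /mapP[c cS ->] /mapP[d dS ->] /= cn dp].
    have : (c.1.1, rest c, c.2) \in eliminate.
      rewrite mem_cat map_f //.
      by rewrite mem_filter c0 eqxx.
    by move=> /sat; rewrite /slack /=; lra.
  have : (pivot d *: c.1.1 - pivot c *: d.1.1,
        pivot d *: rest c - pivot c *: rest d,
        pivot d * c.2 - pivot c * d.2) \in eliminate.
    rewrite mem_cat; apply/orP; right; apply/allpairsP; exists (c, d).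
    by rewrite !mem_filter cn dp.
  by move=> /sat; rewrite /slack /= !dotBl !dotZl; lra.
rewrite mem_cat => /orP[/mapP[c + ->]|/allpairsP[[c d] /= [+ + ->]]].
  rewrite mem_filter => /andP[/eqP c0 cS].
  by have := S0 _ (map_f _ cS) c0; rewrite /slack /=; lra.
rewrite !mem_filter => /andP[cn cS] /andP[dp dS].
have := Spm _ _ (map_f _ cS) (map_f _ dS) cn dp.
by rewrite /slack /= !dotBl !dotZl; lra.
Qed.

(** Once the other coordinates are fixed, the eliminated one solves a system in
    one unknown whose right-hand sides move by at most a multiple of the
    displacement; dividing by the pivots gives the constant, to which a zero
    pivot contributes nothing because its inverse is [0]. *)
Lemma eliminated_lipschitz : exists2 L : R, 0 <= L &
  forall x y x' y' s', satisfies S x' (col_mx s'%:M y') ->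
    satisfies eliminate x y ->
    exists2 s : R, satisfies S x (col_mx s%:M y) &
      `|s' - s| <= L * (enorm (x' - x) + enorm (y' - y)).
Proof.
pose w c : R := enorm c.1.1 + enorm (rest c).
have w0 c : 0 <= w c by rewrite addr_ge0 ?enorm_ge0.
pose L := \sum_(c <- S) w c / `|pivot c|.
have L0 : 0 <= L by apply: sumr_ge0 => c _; rewrite divr_ge0.
have wL c : c \in S -> pivot c != 0 -> w c <= `|pivot c| * L.
  move=> cS c0; rewrite mulrC -ler_pdivrMr ?normr_gt0 // /L (big_rem c) //=.
  by rewrite lerDl; apply: sumr_ge0 => d _; rewrite divr_ge0.
exists L => // x y x' y' s' sat' /satisfies_eliminate[t sat].
pose D := enorm (x' - x) + enorm (y' - y).
have D0 : 0 <= D by rewrite addr_ge0 ?enorm_ge0.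
have [||e|s sS near] := @one_variable_near _
  [seq (pivot c, slack x y c) | c <- S] s' (L * D).
- exact: mulr_ge0.
- by exists t; apply/satisfies_pivot.
- move=> /mapP[c cS ->] /=.
  have [c0|c0] := eqVneq (pivot c) 0.
    rewrite c0 normr0 !mul0r addr0.
    by move/satisfies_pivot: sat => /(_ _ (map_f _ cS)) /=; rewrite c0 mul0r.
  move/satisfies_pivot: sat' => /(_ _ (map_f _ cS)) /=; rewrite /slack.
  have := dot_le_enorm c.1.1 (x - x'); have := dot_le_enorm (rest c) (y - y').
  rewrite !dotBr (enormBC x) (enormBC y).
  have := ler_wpM2r D0 (wL _ cS c0).
  have : enorm c.1.1 * enorm (x' - x) + enorm (rest c) * enorm (y' - y)
         <= w c * D.
    rewrite /w /D mulrDl lerD // ler_wpM2l ?enorm_ge0 //.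
      by rewrite lerDl enorm_ge0.
    by rewrite lerDr enorm_ge0.
  lra.
- by exists s => //; apply/satisfies_pivot.
Qed.

End Step.

(** Induction on the number of unknowns. Elimination does not change the domain,
    so its closedness reduces to that of an intersection of half-spaces; the
    constants of the successive steps compose. *)
Lemma satisfies_dom_closed_lipschitz (m : nat)
    (S : seq ('cV[R]_n * 'cV[R]_m * R)) :
  closed [set x | exists y, satisfies S x y] /\
  exists2 kappa : R, 0 <= kappa &
    forall x x' y', (exists y, satisfies S x y) -> satisfies S x' y' ->
      exists2 y, satisfies S x y & enorm (y' - y) <= kappa * enorm (x' - x).
Proof.
elim: m S => [|m IH] S.
  have dot0 (b y : 'cV[R]_0) : dot b y = 0 by rewrite dotE big_ord0.
  split; last first.
    exists 0 => // x x' y' [y sat] _; exists y => //.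
    by rewrite /enorm big_ord0 sqrtr0 mul0r.
  rewrite (_ : [set x | _] =
      \bigcap_(c in [set` S]) [set x | dot c.1.1 x <= c.2]).
    by apply: closed_bigI => c _; exact: closed_halfspace.
  apply/seteqP; split=> x.
    by move=> [y sat] c cS; have := sat c cS; rewrite dot0 addr0.
  by move=> sat; exists 0 => c cS; rewrite dot0 addr0; exact: sat.
have [closed_dom [k k0 lip]] := IH (eliminate S).
have domE x : (exists y, satisfies S x y) <->
    exists y, satisfies (eliminate S) x y.
  split=> [[y sat]|[y /satisfies_eliminate[s sat]]].
    2: by exists (col_mx s%:M y).
  exists (dsubmx (y : 'cV_(1 + m))); apply/satisfies_eliminate.
  exists (usubmx (y : 'cV_(1 + m)) 0 0).
  by rewrite -mx11_scalar vsubmxK.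
split.
  rewrite (_ : [set x | _] =
    [set x | exists y, satisfies (eliminate S) x y]) //.
  by apply/seteqP; split=> x /domE.
have [L L0 lipS] := eliminated_lipschitz S.
(* The remaining coordinates move by [k |x' - x|], hence the eliminated one by
   [L (1 + k) |x' - x|]. *)
exists (L * (1 + k) + k) => [|x x' y' /domE xdom sat'].
  by rewrite addr_ge0 ?mulr_ge0 ?addr_ge0.
move: sat'; rewrite -[y'](@vsubmxK _ 1 m) [usubmx _]mx11_scalar => sat'.
set s' := usubmx _ 0 0 in sat' *; set v' := dsubmx _ in sat' *.
have [|v sat near_v] := lip x x' v' xdom.
  by apply/satisfies_eliminate; exists s'.
have [s satS near_s] := lipS _ _ _ _ _ sat' sat.
exists (col_mx s%:M v) => //.
apply: (le_trans (enorm_col_mxB _ _ _ _)); rewrite mulrDl lerD //.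
apply: (le_trans near_s); rewrite -mulrA ler_wpM2l // mulrDl mul1r lerD2l.
exact: near_v.
Qed.

Lemma closed_satisfies (m : nat) (S : seq ('cV[R]_n * 'cV[R]_m * R)) x :
  closed [set y | satisfies S x y].
Proof.
rewrite (_ : [set y | _] =
    \bigcap_(c in [set` S]) [set y | dot c.1.2 y <= c.2 - dot c.1.1 x]).
  by apply: closed_bigI => c _; exact: closed_halfspace.
by apply/seteqP; split=> y sat c cS; have := sat c cS; rewrite /= lerBrDl.
Qed.

Lemma polyhedral2_satisfies (m : nat) (A : set ('cV[R]_n * 'cV[R]_m)) :
  polyhedral2 A ->
  exists S, forall x y, A (x, y) <-> satisfies S x y.
Proof.
move=> [k [alpha [beta stackA]]].
exists [seq (usubmx (alpha j), dsubmx (alpha j), beta j) | j <- enum 'I_k].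
move=> x y; have -> : A (x, y) <-> (@stack_cV R n m @` A) (col_mx x y).
  split=> [Axy|[[x' y'] Axy /eq_col_mx[<- <-]] //]; first by exists (x, y).
have dot_stack j : ((alpha j)^T *m col_mx x y) 0 0 =
    dot (usubmx (alpha j)) x + dot (dsubmx (alpha j)) y.
  by rewrite -[alpha j in LHS]vsubmxK tr_col_mx mul_row_col mxE.
rewrite stackA; split=> [sat _ /mapP[j _ ->]|sat j] /=.
  by rewrite -dot_stack; exact: sat.
rewrite dot_stack.
apply: (sat (usubmx (alpha j), dsubmx (alpha j), beta j)).
by apply: map_f; rewrite mem_enum.
Qed.

End Elimination.

(** * Finite closed families along a segment *)

Section Segments.
Variable R : realType.

(** A set of the family that misses the point of parameter [s] misses a
    neighbourhood of it, and a finite family has a common neighbourhood. *)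
Lemma near_segment_closed (n l : nat) (D : 'I_l -> set 'cV[R]_n)
    (p v : 'cV[R]_n) (s : R) :
  (forall i, closed (D i)) ->
  exists2 e : R, 0 < e &
    forall t i, `|s - t| < e -> D i (p + t *: v) -> D i (p + s *: v).
Proof.
move=> Dcl.
have /nbhs_ballP[e /= e0 near_s] : nbhs s
    [set t | forall i, D i (p + t *: v) -> D i (p + s *: v)].
  apply: (@filter_forall _ _ (fun i t => D i (p + t *: v) -> D i (p + s *: v)) _
    (nbhs_filter s)) => i.
  have [Ds|nDs] := pselect (D i (p + s *: v)); first by apply: nearW.
  have cont : {for s, continuous (fun t : R => p + t *: v)}.
    apply: cvgD; first exact: cvg_cst.
    by apply: (@cvgZr_tmp R 'cV[R]_n).
  have : nbhs (p + s *: v) (~` D i).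
    by apply: open_nbhs_nbhs; split=> //; exact: closed_openC.
  by move=> /cont; apply: (@filterS _ _ (nbhs_filter s)) => t.
by exists e => // t i st; apply: near_s.
Qed.

(** Let [s] be the supremum of the parameters reachable from [0]. By
    [near_segment_closed], one step joins [s] to every close parameter, on either
    side; hence [s] is reachable, and it cannot be less than [1]. *)
Lemma segment_chain (n l : nat) (D : 'I_l -> set 'cV[R]_n) (p v : 'cV[R]_n)
    (reach : R -> R -> Prop) :
  (forall i, closed (D i)) ->
  (forall t, 0 <= t <= 1 -> exists i, D i (p + t *: v)) ->
  (forall s t i, s <= t -> D i (p + s *: v) -> D i (p + t *: v) -> reach s t) ->
  (forall r s t, reach r s -> reach s t -> reach r t) ->
  reach 0 1.
Proof.
move=> Dcl cover step trans.
pose S : set R := [set t | 0 <= t <= 1 /\ reach 0 t].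
have S0 : S 0.
  have c0 : 0 <= (0 : R) <= 1 by rewrite lexx ler01.
  by split=> //; have [i Di] := cover 0 c0; exact: (step _ _ i).
have Sub : ubound S 1 by move=> t [/andP[]].
have Ssup : has_sup S by split; [exists 0 | exists 1].
pose s := sup S.
have s0 : 0 <= s by apply: ub_le_sup S0; exists 1.
have s1 : s <= 1 by apply: ge_sup; first by exists 0.
have [e e0 near_s] := near_segment_closed p v s Dcl.
have reach_s : reach 0 s.
  have [t [t01 reach_t] st] := sup_adherent e0 Ssup.
  have ts : t <= s by apply: ub_le_sup; [exists 1 | split].
  have [i Dt] := cover t t01.
  apply: (trans _ t) => //; apply: (step _ _ i) => //.
  apply: (near_s t i) => //; rewrite ger0_norm ?subr_ge0 //.
  by move: st; rewrite -/s; lra.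
have [<-//|s_neq1] := eqVneq s 1.
have {s_neq1} s_lt1 : s < 1 by rewrite lt_neqAle s_neq1.
pose t := Num.min 1 (s + e / 2).
have st : s < t by rewrite lt_min s_lt1 ltrDl divr_gt0.
have t1 : t <= 1 by rewrite ge_min lexx.
have te : t <= s + e / 2 by rewrite ge_min lexx orbT.
have t01 : 0 <= t <= 1 by rewrite t1 (le_trans s0) // ltW.
have [i Dt] := cover t t01.
suff : t <= s by rewrite leNgt st.
apply: ub_le_sup; first by exists 1.
split=> //; apply: (trans _ s) => //; apply: (step _ _ i (ltW st) _ Dt).
apply: (near_s t i _ Dt); rewrite distrC gtr0_norm ?subr_gt0 //; lra.
Qed.

End Segments.

(** * Lipschitz estimates for multifunctions *)

Lemma convex_set_segment (R : realType) (V : lmodType R) (A : set V)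
    (x y : V) (t : R) :
  convex_set A -> A x -> A y -> 0 <= t <= 1 -> A (y + t *: (x - y)).
Proof.
move=> Aconv Ax Ay /andP[t0 t1].
have := Aconv x y (Itv01 t0 t1) (mem_set Ax) (mem_set Ay).
rewrite inE /conv /= /unstable.onem scalerBl scale1r scalerBr.
by rewrite addrCA [t *: x + _]addrC addrA.
Qed.

Section LipschitzMultifunctions.
Variables (R : realType) (n m : nat).
Implicit Types (G : 'cV[R]_n -> set 'cV[R]_m) (X : set 'cV[R]_n).

(** The metric content of [mf_lipschitz], without the closed values and with the
    enlargement by a ball replaced by a bound on the norm. *)
Definition lipschitz_selection G X (kappa : R) : Prop :=
  forall x x' y', X x -> X x' -> G x' y' ->
    exists2 y, G x y & enorm (y' - y) <= kappa * enorm (x' - x).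

Lemma lipschitz_selection_le G X (k k' : R) :
  k <= k' -> lipschitz_selection G X k -> lipschitz_selection G X k'.
Proof.
move=> kk' lip x x' y' Xx Xx' Gy'; have [y Gy near_y] := lip _ _ _ Xx Xx' Gy'.
by exists y => //; apply: (le_trans near_y); rewrite ler_wpM2r ?enorm_ge0.
Qed.

Lemma enlargementE (A : set 'cV[R]_m) (r : R) (y' : 'cV[R]_m) : 0 <= r ->
  [set y + r *: b | y in A & b in @unit_eball R m] y' <->
  exists2 y, A y & enorm (y' - y) <= r.
Proof.
move=> r0; split=> [[y Ay [b b1 <-]]|[y Ay yr]].
  exists y => //; rewrite addrC addKr enormZ ger0_norm // -[leRHS]mulr1.
  exact: ler_wpM2l.
exists y => //; have [r_eq0|r_neq0] := eqVneq r 0.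
  exists 0; first by rewrite /unit_eball /= enorm0 ler01.
  have /enorm_eq0/eqP : enorm (y' - y) = 0.
    by apply/eqP; rewrite eq_le enorm_ge0 andbT -r_eq0.
  by rewrite subr_eq0 scaler0 addr0 => /eqP.
have rp : 0 < r by rewrite lt_neqAle eq_sym r_neq0.
exists (r^-1 *: (y' - y)).
  rewrite /unit_eball /= enormZ gtr0_norm ?invr_gt0 //.
  by rewrite mulrC ler_pdivrMr // mul1r.
by rewrite scalerA divff // scale1r addrC subrK.
Qed.

Lemma mf_lipschitzE G X (kappa : R) :
  mf_lipschitz G X kappa <->
  [/\ 0 <= kappa, forall x, X x -> G x !=set0 /\ closed (G x) &
      lipschitz_selection G X kappa].
Proof.
split=> -[k0 ne lip]; split=> // x x'.
  move=> y' Xx Xx' /(lip x x' Xx Xx').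
  by rewrite enlargementE // mulr_ge0 ?enorm_ge0.
move=> Xx Xx' y' Gy'; apply/enlargementE; first by rewrite mulr_ge0 ?enorm_ge0.
exact: lip Gy'.
Qed.

Lemma segment_dist (x x' : 'cV[R]_n) (s t : R) : s <= t ->
  enorm (x' + s *: (x - x') - (x' + t *: (x - x'))) = (t - s) * enorm (x' - x).
Proof.
move=> st; rewrite opprD addrACA subrr add0r -scalerBl enormZ.
by rewrite ler0_norm ?subr_le0 // opprB enormBC.
Qed.

(** The distances between successive points of a segment add up to its length, so
    passing from one set of the cover to the next costs nothing in the
    constant. *)
Lemma lipschitz_selection_cover G X (l : nat) (D : 'I_l -> set 'cV[R]_n)
    (kappa : R) :
  (forall x x' t, X x -> X x' -> 0 <= t <= 1 -> X (x' + t *: (x - x'))) ->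
  X `<=` \bigcup_i D i ->
  (forall i, closed (D i)) ->
  (forall i, lipschitz_selection G (D i) kappa) ->
  lipschitz_selection G X kappa.
Proof.
move=> Xconv XD Dcl lip x x' y' Xx Xx' Gy'.
pose p t := x' + t *: (x - x').
pose reach s t := forall y', G (p s) y' ->
  exists2 y, G (p t) y & enorm (y' - y) <= kappa * ((t - s) * enorm (x' - x)).
have p0 : p 0 = x' by rewrite /p scale0r addr0.
have p1 : p 1 = x by rewrite /p scale1r addrC subrK.
have : reach 0 1.
  apply: (segment_chain (D := D) (p := x') (v := x - x')) => //.
  - by move=> t t01; have [i _ Di] := XD _ (Xconv _ _ _ Xx Xx' t01); exists i.
  - move=> s t i st Ds Dt z Gz; have [y Gy yz] := lip i _ _ _ Dt Ds Gz.
    by exists y => //; rewrite -segment_dist.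
  - move=> r s t rs ss z /rs[y /ss[w Gw yw] zy]; exists w => //.
    by apply: (le_trans (enorm_triangle y z w)); lra.
rewrite /reach p0 p1 subr0 mul1r; exact.
Qed.

(** Let [f] be the distance from [y'] to [C x]. Take [y0] in [C x] at distance
    almost [f]; by convexity the point [z] dividing the segment from [(x', y')]
    to [(x, y0)] at [t < 1] is in the graph of [C], hence in some piece [P i],
    and for [t] close to [1] this piece is also defined at [x]. Its selection
    from [z] gives [f <= t f + kappa (1 - t) |x' - x|] up to an arbitrarily small
    error, and one divides by [1 - t]. The constant [kappa + 1] leaves room for
    a distance that is not attained. *)
Lemma convex_graph_lipschitz (C : 'cV[R]_n -> set 'cV[R]_m) (l : nat)
    (P : 'I_l -> 'cV[R]_n -> set 'cV[R]_m) (kappa : R) :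
  (forall x y x' y' t, C x y -> C x' y' -> 0 <= t <= 1 ->
     C (x' + t *: (x - x')) (y' + t *: (y - y'))) ->
  (forall x y, C x y -> exists i, P i x y) ->
  (forall i x y x', P i x y -> C x' !=set0 -> P i x' `<=` C x') ->
  (forall i, closed [set x | P i x !=set0]) ->
  (forall i, lipschitz_selection (P i) [set x | P i x !=set0] kappa) ->
  0 <= kappa ->
  lipschitz_selection C [set x | C x !=set0] (kappa + 1).
Proof.
move=> Cconv CP PC Pcl lip k0 x x' y' Cx Cx' Cy'.
have [xx'|x_neq] := eqVneq x' x.
  by exists y'; rewrite -?xx' // !subrr !enorm0 mulr0.
pose d := enorm (x' - x).
have d0 : 0 < d.
  rewrite lt_neqAle enorm_ge0 andbT eq_sym; apply: contra_neq x_neq.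
  by move=> /enorm_eq0/eqP; rewrite subr_eq0 => /eqP.
pose E : set R := [set enorm (y' - y) | y in C x].
have Ene : E !=set0 by have [y Cy] := Cx; exists (enorm (y' - y)); exists y.
have Elb : lbound E 0 by move=> _ [y _ <-]; exact: enorm_ge0.
have Einf : has_inf E by split => //; exists 0.
suff inf_le : inf E <= kappa * d.
  have [_ [y Cy <-] near_y] := inf_adherent d0 Einf.
  by exists y => //; rewrite -/d; apply: ltW; apply: (lt_le_trans near_y); lra.
have [e e0 near1] := near_segment_closed x' (x - x') 1 Pcl.
pose t := Num.max 0 (1 - e / 2).
have t0 : 0 <= t by rewrite le_max lexx.
have t1 : t < 1 by rewrite gt_max ltr01 /=; lra.
have te : 1 - e / 2 <= t by rewrite le_max lexx orbT.
have t01 : 0 <= t <= 1 by rewrite t0 ltW.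
(* The error is scaled by [1 - t], which is possible since [t] was fixed first;
   it remains [r] after the division. *)
apply/ler_addgt0Pr => r r0.
have r'0 : 0 < (1 - t) * r by rewrite mulr_gt0 // subr_gt0.
have [_ [y0 Cy0 <-] near_y0] := inf_adherent r'0 Einf.
have Cz := Cconv _ _ _ _ t Cy0 Cy' t01.
have [i Pz] := CP _ _ Cz.
have Px : P i x !=set0.
  have := near1 t i.
  rewrite gtr0_norm ?subr_gt0 // scale1r [x' + (_ - _)]addrC subrK.
  by apply; [lra | exists (y' + t *: (y0 - y'))].
have Pxt : P i (x' + t *: (x - x')) !=set0 by exists (y' + t *: (y0 - y')).
have [y Py] := lip i _ _ _ Px Pxt Pz.
have -> : enorm (x' + t *: (x - x') - x) = (1 - t) * d.
  by rewrite -segment_dist ?(ltW t1) // scale1r [x' + (x - x')]addrC subrK.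
set z := y' + _ => near_y.
have Cy : C x y by exact: PC Pz Cx _ Py.
have inf_y : inf E <= enorm (y' - y) by apply: ge_inf; [exists 0 | exists y].
have y'z : enorm (y' - z) = t * enorm (y' - y0).
  by rewrite /z opprD addNKr -scalerN opprB enormZ ger0_norm.
have := enorm_triangle z y' y; rewrite y'z => tri.
have := ler_wpM2l t0 (ltW near_y0) => tnear.
have r'r : t * ((1 - t) * r) <= (1 - t) * r by rewrite ler_piMl // ltW.
have key : (1 - t) * inf E <= (1 - t) * (kappa * d + r) by lra.
by rewrite -(ler_pM2l (_ : 0 < 1 - t)) // subr_gt0.
Qed.

End LipschitzMultifunctions.

(** * Polyhedral multifunctions *)

Section PolyhedralSections.
Variables (R : realType) (n m : nat) (A : set ('cV[R]_n * 'cV[R]_m)).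
Hypothesis polyA : polyhedral2 A.

Lemma polyhedral2_closed_section x : closed [set y | A (x, y)].
Proof.
have [S AS] := polyhedral2_satisfies polyA.
rewrite (_ : [set y | _] = [set y | satisfies S x y]).
  exact: closed_satisfies.
by apply/seteqP; split=> y /AS.
Qed.

Lemma polyhedral2_lipschitz :
  closed (fst @` A) /\
  exists2 kappa : R, 0 <= kappa &
    lipschitz_selection (fun x => [set y | A (x, y)]) (fst @` A) kappa.
Proof.
have [S AS] := polyhedral2_satisfies polyA.
have [dom_closed [k k0 lip]] := satisfies_dom_closed_lipschitz S.
have domE : fst @` A = [set x | exists y, satisfies S x y].
  apply/seteqP; split=> [_ [[x y] Axy <-]|x [y /AS Axy]].
    by exists y; apply/AS.
  by exists (x, y).
rewrite domE; split=> //; exists k => // x x' y' xdom _ /AS sat'.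
by have [y /AS Axy near_y] := lip _ _ _ xdom sat'; exists y.
Qed.

End PolyhedralSections.

Section LipschitzPolyhedral.
Variables (R : realType) (n m l : nat).
Variables (G : 'cV[R]_n -> set 'cV[R]_m).
Variables (Gs : 'I_l -> set ('cV[R]_n * 'cV[R]_m)).
Hypothesis hGs : polyhedral_decomposition G Gs.

Lemma decompositionE x y : G x y <-> exists i, Gs i (x, y).
Proof.
have [_ gphE] := hGs; have -> : G x y = mf_gph G (x, y) by [].
by rewrite gphE; split=> [[i _ Gi]|[i Gi]]; exists i.
Qed.

Lemma decomposition_closed x : closed (G x).
Proof.
have [poly _] := hGs.
rewrite (_ : G x = \bigcup_(i in [set: 'I_l]) [set y | Gs i (x, y)]).
  apply: closed_bigcup => [|i _]; first exact: finite_finset.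
  exact: polyhedral2_closed_section.
apply/seteqP; split=> y; first by move=> /decompositionE[i Gi]; exists i.
by move=> [i _ Gi]; apply/decompositionE; exists i.
Qed.

End LipschitzPolyhedral.

Theorem lemma2p1 (R : realType) (n m l : nat)
    (G : 'cV[R]_n -> set 'cV[R]_m)
    (Gs : 'I_l -> set ('cV[R]_n * 'cV[R]_m))
    (Q : 'I_l -> set 'cV[R]_n)
    (hG : polyhedral_multifunction G)
    (hGs : polyhedral_decomposition G Gs)
    (hQ : forall i, Q i = fst @` Gs i)
    (hdom : convex_set (mf_dom G))
    (hgph : forall i, convex_set (mf_gph (mf_restrict G (Q i)))) :
  (forall i, exists2 kappa : R, 0 < kappa & mf_lipschitz G (Q i) kappa) /\
  (forall kappa : 'I_l -> R,
     (forall i, 0 < kappa i /\ mf_lipschitz G (Q i) (kappa i)) ->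
     mf_lipschitz G (mf_dom G) (\big[Num.max/0]_(i < l) kappa i)).
Proof.
have [poly _] := hGs.
have Qclosed i : closed (Q i).
  by rewrite hQ; have [] := polyhedral2_lipschitz (poly i).
have Qdom i x : Q i x -> G x !=set0.
  rewrite hQ => -[[z y] Gi /= <-]; exists y.
  by apply/(decompositionE hGs); exists i.
split=> [i|kappa lip].
  pose P j x := [set y | Gs j (x, y)].
  have QE j : Q j = [set x | P j x !=set0].
    rewrite hQ; apply/seteqP; split=> [_ [[x y] Gxy <-]|x [y Gxy]].
      by exists y.
    by exists (x, y).
  have /choice[k klip] : forall j, exists k : R,
      0 <= k /\ lipschitz_selection (P j) (Q j) k.
    by move=> j; have [_ [k k0]] := polyhedral2_lipschitz (poly j);
      rewrite hQ; exists k.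
  pose K := \sum_j k j.
  have K0 : 0 <= K by apply: sumr_ge0 => j _; case: (klip j).
  pose C := mf_restrict G (Q i).
  have CE x y : C x y <-> Q i x /\ G x y.
    rewrite /C /mf_restrict; case: ifPn => [/set_mem|/negP nQ].
      by split=> // -[].
    by split=> // -[/mem_set].
  have Cdom x : Q i x -> C x !=set0.
    by move=> Qx; have [y Gy] := Qdom _ _ Qx; exists y; apply/CE.
  have lipC : lipschitz_selection C [set x | C x !=set0] (K + 1).
    apply: (@convex_graph_lipschitz _ _ _ C l P).
    - move=> x y x' y' t Cy Cy' t01.
      exact: (@convex_set_segment _ _ _ (x, y) (x', y') t (hgph i)).
    - by move=> x y /CE[_ /(decompositionE hGs)].
    - move=> j x y x' _ [z /CE[Qx' _]] w Pw; apply/CE; split=> //.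
      by apply/(decompositionE hGs); exists j.
    - by move=> j; rewrite -QE.
    - move=> j; rewrite -QE; have [_] := klip j; apply: lipschitz_selection_le.
      rewrite /K (bigD1 j) //= lerDl; apply: sumr_ge0 => j' _.
      by case: (klip j').
    - exact: K0.
  exists (K + 1); first by rewrite ltr_wpDl.
  apply/mf_lipschitzE; split; first by rewrite addr_ge0.
    by move=> x Qx; split; [exact: Qdom Qx | exact: decomposition_closed hGs _].
  move=> x x' y' Qx Qx' Gy'.
  have Cy' : C x' y' by apply/CE.
  have [y /CE[_ Gy] near_y] := lipC x x' y' (Cdom _ Qx) (Cdom _ Qx') Cy'.
  by exists y.
apply/mf_lipschitzE; split.
- elim/big_ind: _ => // [a b a0 b0|i _]; first by rewrite le_max a0.
  by case: (lip i) => /ltW.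
- by move=> x Gx; split; [exact: Gx | exact: decomposition_closed hGs _].
- apply: (lipschitz_selection_cover _ _ Qclosed).
  + by move=> x x' t Gx Gx' t01; exact: (convex_set_segment hdom).
  + move=> x [y /(decompositionE hGs)[i Gi]]; exists i => //.
    by rewrite hQ; exists (x, y).
  + move=> i; have [_ /mf_lipschitzE[_ _]] := lip i.
    by apply: lipschitz_selection_le; exact: le_bigmax.
Qed.
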